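(* For all integers $r\ge 3$ and $s\ge 2$ there exists $n(r,s)$ such that for every integer $n>n(r,s)$, $$m_0(s,\underbrace{n,\dots,n}_{r})=sn^{r-1}-(n-1)^{r-1}+n-s.$$
   Context: For integers $n_1\ge\dots\ge n_r$, let $X_\ell=[n_\ell]$. An $r$-partite $r$-graph is a family $\mathcal F\subseteq X_1\times\dots\times X_r$; its vertices are the pairs $(\ell,x)$ with $x\in X_\ell$, and an edge $A=(a_1,\dots,a_r)$ contains the vertex $(\ell,x)$ iff $a_\ell=x$. Two edges $A,B$ are disjoint if $A[\ell]\ne B[\ell]$ for all $\ell$. The matching number $\nu(\mathcal F)$ is the maximum number of pairwise disjoint edges of $\mathcal F$. A transversal is a set $T$ of vertices such that every edge of $\mathcal F$ contains a vertex of $T$; $\tau(\mathcal F)$ is the minimum size of a transversal. For integers $r\ge 3$ and $n_1\ge\dots\ge n_r>s\ge 1$, $m_0(s,n_1,\dots,n_r)$ denotes the maximum of $|\mathcal F|$ over all $\mathcal F\subseteq X_1\times\dots\times X_r$ with $\nu(\mathcal F)\le s<\tau(\mathcal F)$. *)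

(* Defs.v *)
(* r-partite r-graphs with all parts equal to [n] = 'I_n. *)
From mathcomp Require Import all_boot all_order all_algebra.
Set Implicit Arguments. Unset Strict Implicit. Unset Printing Implicit Defensive.

(* Edges: elements of X_1 x ... x X_r with X_l = 'I_n (values 0..n-1 stand for 1..n). *)
Definition edge (r n : nat) := {ffun 'I_r -> 'I_n}.
Definition vertex (r n : nat) := ('I_r * 'I_n)%type.

Definition contains (r n : nat) (A : edge r n) (v : vertex r n) : bool :=
  A v.1 == v.2.

Definition disjoint_edges (r n : nat) (A B : edge r n) : bool :=
  [forall l, A l != B l].

Definition is_matching (r n : nat) (F M : {set edge r n}) : bool :=
  (M \subset F) &&
  [forall A in M, forall B in M, (A != B) ==> disjoint_edges A B].

Definition nu (r n : nat) (F : {set edge r n}) : nat :=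
  \max_(M : {set edge r n} | is_matching F M) #|M|.

Definition is_transversal (r n : nat) (F : {set edge r n}) (T : {set vertex r n}) : bool :=
  [forall A in F, exists v in T, contains A v].

(* transversal number: minimum size of a transversal (the full vertex set,
   of size r*n, is always a transversal when r >= 1) *)
Definition tau (r n : nat) (F : {set edge r n}) : nat :=
  \big[minn/(r * n)%N]_(T : {set vertex r n} | is_transversal F T) #|T|.

Definition m0 (r n s : nat) : nat :=
  \max_(F : {set edge r n} | (nu F <= s) && (s < tau F)) #|F|.

(* Main.v *)
(** Call a vertex big if its degree exceeds [r(s+1)n^(r-2)]. A matching avoiding
    a set S of big vertices extends greedily by one edge through each element
    of S, so there are fewer than s big vertices. If there are at most s-2, the
    edges avoiding them number only [O(n^(r-2))], because a maximal matching
    covers them with vertices that are not big. If the set S of big vertices has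
    size s-1, the edges avoiding S form an intersecting family G without a
    covering vertex. Call a pair of vertices heavy if its codegree in G exceeds
    [r n^(r-3)]: every edge of G meets every heavy pair. Hence, unless G is small,
    G lies in a Hilton-Milner family (r-1 heavy pairs at one vertex) or consists
    of edges containing two of three fixed vertices (a heavy triangle). Both
    families have at most [n^(r-1) - (n-1)^(r-1) + n - 1] edges and contain s-1
    distinct edges hitting S, which G misses. The extremal example consists of
    all edges hitting s-1 vertices of one part and a Hilton-Milner family centred
    in the same part. *)

From mathcomp Require Import all_boot all_order all_algebra zify.
(* Imported last: [is_transversal] also names a notion of finset. *)
Require Import Defs.
Set Implicit Arguments. Unset Strict Implicit. Unset Printing Implicit Defensive.

(** * Vertex sets of edges and basic counting *)

Lemma leq_card_bigcup (I T : finType) (P : pred I) (X : I -> {set T}) :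
  #|\bigcup_(i | P i) X i| <= \sum_(i | P i) #|X i|.
Proof.
elim/big_ind2: _ => [|a Y b Z Ya Zb|//]; first by rewrite cards0.
by have := (leq_card_setU Y Z).1 => /leq_trans; apply; apply: leq_add.
Qed.

Section Hypergraphs.

Variables r n : nat.
Implicit Types (A B E : edge r n) (F G K M : {set edge r n}).
Implicit Types (u v w x : vertex r n) (S T W : {set vertex r n}).

Definition verts A : {set vertex r n} := [set v | contains A v].

Definition meets A B := ~~ [disjoint verts A & verts B].

Definition thr T : {set edge r n} := [set A | T \subset verts A].

Definition hitting W : {set edge r n} := [set A | ~~ [disjoint verts A & W]].

Definition upd A x : edge r n := [ffun l => if l == x.1 then x.2 else A l].

Lemma mem_verts A v : (v \in verts A) = (A v.1 == v.2).
Proof. by rewrite inE. Qed.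

Lemma mem_thr A T : (A \in thr T) = (T \subset verts A).
Proof. by rewrite inE. Qed.

Lemma meetsP A W : reflect (exists2 v, v \in verts A & v \in W)
  (~~ [disjoint verts A & W]).
Proof.
apply: (iffP pred0Pn) => [[v /andP[vA vW]]|[v vA vW]]; exists v => //.
by apply/andP.
Qed.

Lemma meetsxx A : 0 < r -> meets A A.
Proof.
by move=> r_gt0; apply/meetsP; exists (Ordinal r_gt0, A (Ordinal r_gt0)); rewrite mem_verts.
Qed.

Lemma disjoint_edgesE A B : disjoint_edges A B = ~~ meets A B.
Proof.
rewrite /meets negbK; apply/forallP/pred0P => [dAB [l y]|dAB l] /=.
  rewrite !mem_verts /=; apply/negP => /andP[/eqP Al /eqP Bl].
  by move: (dAB l); rewrite Al Bl eqxx.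
apply/negP => /eqP eAB; move: (dAB (l, A l)) => /=.
by rewrite !mem_verts /= -eAB eqxx.
Qed.

Lemma verts_inj_part A u v :
  u \in verts A -> v \in verts A -> u.1 = v.1 -> u = v.
Proof.
by case: u v => [l x] [m y]; rewrite !mem_verts /= => /eqP <- /eqP <- ->.
Qed.

Lemma verts_upd A x v :
  (v \in verts (upd A x)) = (if v.1 == x.1 then v == x else v \in verts A).
Proof.
rewrite !mem_verts ffunE; case: ifP => // /eqP vx.
by case: v x vx => [l y] [m z] /= ->; rewrite xpair_eqE eqxx /= eq_sym.
Qed.

Lemma mem_upd A x : x \in verts (upd A x).
Proof. by rewrite verts_upd !eqxx. Qed.

Lemma card_verts A : #|verts A| = r.
Proof.
have -> : verts A = [set (l, A l) | l : 'I_r].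
  apply/setP => -[l y]; rewrite mem_verts /=; apply/eqP/imsetP => [<-|].
    by exists l.
  by case=> m _ [-> ->].
by rewrite card_imset ?card_ord // => l m [].
Qed.

Lemma card_edge_prod (P : 'I_r -> {set 'I_n}) :
  #|[set A : edge r n | [forall l, A l \in P l]]| = \prod_(l < r) #|P l|.
Proof.
rewrite cardsE; transitivity #|(family P : pred {ffun 'I_r -> 'I_n})|.
  by apply: eq_card => A; rewrite !inE.
rewrite card_family foldrE big_map big_enum /=.
by [].
Qed.

(** Coordinates in the parts met by [T] are forced, the others are free. The edge [A] certifies that
    [T] takes at most one vertex per part; otherwise [thr T] is empty. *)
Lemma card_thr T A : T \subset verts A -> #|thr T| = n ^ (r - #|T|).
Proof.
move=> TA; pose D := [set v.1 | v in T].
have cD : #|D| = #|T|.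
  apply: card_in_imset => u v uT vT; apply: (@verts_inj_part A); exact: (subsetP TA).
have memT l : ((l, A l) \in T) = (l \in D).
  apply/idP/imsetP => [lT|[v vT ->]]; first by exists (l, A l).
  have := subsetP TA _ vT; case: v vT => [m y] /= vT.
  by rewrite mem_verts /= => /eqP ->.
have -> : thr T = [set B : edge r n | [forall l, B l \in if l \in D then [set A l] else setT]].
  apply/setP => B; rewrite !inE; apply/subsetP/forallP => [TB l|BT [l y] vT].
    case: ifP => lD; rewrite inE //.
    by have := TB (l, A l); rewrite memT lD mem_verts => ->.
  have := subsetP TA _ vT; rewrite mem_verts /= => /eqP Al.
  have := BT l; rewrite -memT Al vT inE => /eqP Bl.
  by rewrite mem_verts /= Bl.
rewrite card_edge_prod.
rewrite (eq_bigr (fun l => if l \in ~: D then n else 1)); last first.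
  by move=> l _; rewrite inE; case: (l \in D); rewrite ?cards1 ?cardsT ?card_ord.
by rewrite -big_mkcond /= prod_nat_const cardsCs setCK card_ord cD.
Qed.

Lemma card_thr_le T : #|thr T| <= n ^ (r - #|T|).
Proof.
have [->|[A]] := set_0Vmem (thr T); first by rewrite cards0.
by rewrite inE => /card_thr ->.
Qed.

(** Union bound over [W], the main counting tool; [W] is mostly the vertex set of an edge or of a
    matching. *)
Lemma cover_bound F W c :
  {in F, forall A, ~~ [disjoint verts A & W]} ->
  {in W, forall w, #|[set A in F | w \in verts A]| <= c} ->
  #|F| <= #|W| * c.
Proof.
move=> FW Wc; have sF : F \subset \bigcup_(w in W) [set A in F | w \in verts A].
  apply/subsetP => A AF; have /meetsP[w wA wW] := FW A AF.
  by apply/bigcupP; exists w => //; rewrite inE AF.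
apply: leq_trans (subset_leq_card sF) _.
rewrite -sum_nat_const; apply: leq_trans (leq_card_bigcup _ _) _.
exact: leq_sum.
Qed.

Lemma card_hitting_le W : #|hitting W| <= #|W| * n ^ r.-1.
Proof.
apply: cover_bound => [A|w _]; first by rewrite inE.
apply: leq_trans (_ : #|thr [set w]| <= _); last first.
  by have := card_thr_le [set w]; rewrite cards1 subn1.
by apply/subset_leq_card/subsetP => A; rewrite !inE sub1set inE => /andP[].
Qed.

(** * Matching number and transversal number *)

Lemma is_matchingP F M :
  reflect (M \subset F /\ {in M &, forall A B, A != B -> ~~ meets A B})
    (is_matching F M).
Proof.
apply: (iffP andP) => -[MF dM]; split=> //.
  move=> A B AM BM nAB; rewrite -disjoint_edgesE.
  by move: dM => /forall_inP/(_ _ AM)/forall_inP/(_ _ BM)/implyP; apply.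
apply/forall_inP => A AM; apply/forall_inP => B BM; apply/implyP => nAB.
by rewrite disjoint_edgesE dM.
Qed.

Lemma card_matching_nu F M : is_matching F M -> #|M| <= nu F.
Proof. exact: leq_bigmax_cond. Qed.

Lemma is_transversalP F T :
  reflect {in F, forall A, A \in hitting T} (is_transversal F T).
Proof.
apply: (iffP forall_inP) => tT A /tT.
  by move=> /existsP[v /andP[vT Av]]; rewrite inE; apply/meetsP; exists v; rewrite ?inE.
rewrite inE => /meetsP[v vA vT]; apply/existsP; exists v.
by rewrite vT; rewrite inE in vA.
Qed.

Lemma tau_leq F T : is_transversal F T -> tau F <= #|T|.
Proof.
rewrite /tau => tT; have := mem_index_enum T.
elim: (index_enum _) => // T' l IH; rewrite inE big_cons => /predU1P[<-|/IH le_l].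
  by rewrite tT geq_minl.
by case: ifP => // _; rewrite geq_min le_l orbT.
Qed.

(** The bound [s < r * n] handles the start value of the fold that defines [tau]. *)
Lemma tau_gt F s : s < r * n ->
  (forall T, is_transversal F T -> s < #|T|) -> s < tau F.
Proof.
move=> srn sT; rewrite /tau; elim/big_ind: _ => // a b sa sb.
by rewrite leq_min sa.
Qed.

Lemma avoiding_edge F T : #|T| < tau F ->
  exists2 A, A \in F & A \notin hitting T.
Proof.
move=> Tt; apply/exists_inP; rewrite -[X in is_true X]negbK negb_exists_in.
apply/negP => /forall_inP tT; have : is_transversal F T.
  by apply/is_transversalP => A /tT; rewrite negbK.
by move=> /tau_leq; rewrite leqNgt Tt.
Qed.

(** If distinct x and y gave the same update, x would lie on [E], which avoids [S]. *)
Lemma upd_inj_avoiding E S :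
  E \notin hitting S -> {in S &, injective (upd E)}.
Proof.
rewrite inE negbK => dES x y xS yS eq_xy; have := mem_upd E x.
rewrite eq_xy verts_upd; case: ifP => [_ /eqP //|_ xE].
by have := disjointFr dES xE; rewrite xS.
Qed.

(* The edges [upd E x], for x in S, are distinct members of K outside G. *)
Lemma card_avoiding_le G K E S :
    G \subset K -> {in G, forall A, A \notin hitting S} ->
    E \notin hitting S -> {in S, forall x, upd E x \in K} ->
  #|G| + #|S| <= #|K|.
Proof.
move=> GK GS ES SK; rewrite -(card_in_imset (upd_inj_avoiding ES)).
have dG : [disjoint G & upd E @: S].
  apply/pred0P => A /=; apply/negP => /andP[AG /imsetP[x xS eA]].
  move: (GS A AG); rewrite inE negbK eA => dxS.
  by have := disjointFr dxS (mem_upd E x); rewrite xS.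
have /eqP <- : #|G :|: upd E @: S| == #|G| + #|upd E @: S|.
  by rewrite (leq_card_setU _ _).2.
apply: subset_leq_card; rewrite subUset GK.
by apply/subsetP => _ /imsetP[x xS ->]; apply: SK.
Qed.

Lemma matching_setU1 F M A : is_matching F M -> A \in F ->
  {in M, forall B, ~~ meets A B} -> is_matching F (A |: M).
Proof.
move=> /is_matchingP[MF dM] AF dAM; apply/is_matchingP.
split; first by rewrite subUset sub1set AF.
move=> B C /setU1P[->|BM] /setU1P[->|CM]; rewrite ?eqxx //.
- by move=> _; apply: dAM.
- by move=> _; rewrite /meets disjoint_sym; apply: dAM.
- exact: dM.
Qed.

Lemma matching_set1 F A : A \in F -> is_matching F [set A].
Proof.
move=> AF; rewrite -(setU0 [set A]); apply: matching_setU1 => // [|B].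
  by apply/is_matchingP; split=> [|B C]; rewrite ?sub0set ?inE.
by rewrite inE.
Qed.

Lemma card_bigcup_verts M : #|\bigcup_(A in M) verts A| <= #|M| * r.
Proof.
rewrite -sum_nat_const; apply: leq_trans (leq_card_bigcup _ _) _.
by apply: leq_sum => A _; rewrite card_verts.
Qed.

(** Induction on the size of [S]: an edge through some v in [S] that avoids [M] and the rest of [S]
    joins the matching while v leaves [S], so the sum of sizes is kept. A sum of s + 1 would end in
    a matching larger than [nu F]. The edge exists because at most n^(r-2) edges through v pass
    through any other given vertex. *)
Lemma greedy_matching F S s :
    nu F <= s ->
    {in S, forall v, r * s.+1 * n ^ (r - 2) < #|[set A in F | v \in verts A]|} ->
  forall M, is_matching F M -> {in M, forall A, A \notin hitting S} ->
    #|M| + #|S| <= s.+1 -> #|M| + #|S| <= s.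
Proof.
move=> nuF; move cS : #|S| => k; elim: k S cS => [|k IH] S cS bigS M matM MS le_s.
  by rewrite addn0; apply: leq_trans nuF; apply: card_matching_nu.
have [v vS] : exists v, v \in S by apply/card_gt0P; rewrite cS.
pose W := \bigcup_(A in M) verts A :|: S :\ v.
have cW : #|W| <= r * s.+1.
  apply: leq_trans (leq_card_setU _ _).1 _.
  have cSv : #|S :\ v| = k by have := cardsD1 v S; rewrite vS cS => -[].
  have := card_bigcup_verts M.
  (* The part of v witnesses r > 0, so the k vertices left in [S] cost at most r * k. *)
  by have := ltn_ord v.1; rewrite cSv; move: le_s; nia.
have vW : v \notin W.
  rewrite !inE eqxx orbF; apply/bigcupP => -[A AM vA].
  move: (MS A AM); rewrite inE negbK => dAS.
  by have := disjointFr dAS vA; rewrite vS.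
have [A [AF vA dAW]] : exists A, [/\ A \in F, v \in verts A & [disjoint verts A & W]].
  have [/exists_inP[A AF /andP[vA dAW]]|/exists_inPn nA] :=
    boolP [exists A in F, (v \in verts A) && [disjoint verts A & W]]; first by exists A.
  have := bigS v vS; rewrite ltnNge => /negP[].
  apply: leq_trans (leq_mul cW (leqnn _)); apply: cover_bound => [A|w wW].
    by rewrite inE => /andP[AF vA]; have := nA A AF; rewrite vA.
  have <- : #|[set v; w]| = 2.
    by rewrite cards2; case: eqP vW => // ->; rewrite wW.
  apply: leq_trans (card_thr_le _); apply/subset_leq_card/subsetP => A.
  by rewrite !inE subUset !sub1set !inE -andbA => /and3P[_ -> ->].
have dAM B : B \in M -> ~~ meets A B.
  move=> BM; rewrite negbK; apply: disjointWr dAW.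
  by apply/subsetU/orP; left; apply: bigcup_sup.
have AM : A \notin M.
  by apply/negP => /dAM; rewrite negbK => /pred0P/(_ v) /=; rewrite vA.
have cAM : #|A |: M| = #|M|.+1 by rewrite cardsU1 AM.
rewrite addnS -addSn -cAM; apply: (IH (S :\ v)); last by rewrite cAM addSn -addnS.
- by have := cardsD1 v S; rewrite vS cS => -[].
- by move=> w; rewrite inE => /andP[_]; apply: bigS.
- exact: matching_setU1.
- move=> B /setU1P[->|/MS]; rewrite !inE !negbK.
    by apply: disjointWr dAW; apply: subsetUr.
  by move=> dB; apply: disjointWr dB; apply: subD1set.
Qed.

End Hypergraphs.

(** * Hilton-Milner families *)

Section HiltonMilnerFamily.

Variables r n : nat.
Implicit Types (A B : edge r n) (u v w x : vertex r n).

(** The r-partite Hilton-Milner family: its edges off u agree with [B] outside the part of u and are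
    free inside that part, apart from u. *)
Definition hm_family u B : {set edge r n} :=
  [set A | if u \in verts A then meets A B
           else verts B :\ (u.1, B u.1) \subset verts A].

Lemma mem_hm_family u A B :
  (A \in hm_family u B) =
  if u \in verts A then meets A B else verts B :\ (u.1, B u.1) \subset verts A.
Proof. by rewrite inE. Qed.

Lemma verts_upd_D1 u B :
  verts (upd B u) = u |: verts B :\ (u.1, B u.1).
Proof.
apply/setP => -[l y]; rewrite verts_upd !inE /contains /=.
case: u => [m z] /=; rewrite !xpair_eqE; case: eqVneq => [->|nlm] /=.
  by case: (y =P z) => //= _; case: (B m =P y) => [->|] //=; rewrite ?eqxx ?andbF.
by [].
Qed.

Lemma card_thr1_disjoint u B : u \notin verts B ->
  #|[set A | (u \in verts A) && ~~ meets A B]| = n.-1 ^ r.-1.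
Proof.
move=> uB.
have -> : [set A | (u \in verts A) && ~~ meets A B] =
  [set A : edge r n | [forall l, A l \in if l == u.1 then [set u.2] else ~: [set B l]]].
  apply/setP => A; rewrite !inE -disjoint_edgesE; apply/andP/forallP => [[/eqP uA dAB] l|uA].
    by case: ifP => [/eqP ->|_]; rewrite !inE ?uA //; apply: (forallP dAB).
  have Au : A u.1 = u.2 by apply/eqP; have := uA u.1; rewrite eqxx inE.
  split; first by rewrite /contains Au.
  apply/forallP => l; have := uA l; case: ifP => [/eqP -> _|_]; last by rewrite !inE.
  by rewrite Au eq_sym; rewrite mem_verts in uB.
rewrite card_edge_prod (bigD1 u.1) //= eqxx cards1 mul1n.
rewrite (eq_bigr (fun=> n.-1)); last first.
  by move=> l /negbTE ->; rewrite cardsC1 card_ord.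
rewrite prod_nat_const; congr (_ ^ _).
by rewrite (eq_card (_ : _ =i predC1 u.1)) ?cardC1 ?card_ord.
Qed.

(** Of the n^(r-1) edges through u, (n-1)^(r-1) miss [B]; of the n edges that agree with [B] outside
    the part of u, exactly one passes through u. *)
Lemma card_hm_family u B : u \notin verts B ->
  #|hm_family u B| + n.-1 ^ r.-1 + 1 = n ^ r.-1 + n.
Proof.
move=> uB; pose H := verts B :\ (u.1, B u.1); pose E := upd B u.
have r_gt0 : 0 < r by apply: leq_trans (ltn_ord u.1).
have vE : verts E = u |: H by rewrite verts_upd_D1.
have cH : #|H| = r.-1.
  have := cardsD1 (u.1, B u.1) (verts B).
  by rewrite card_verts mem_verts /= eqxx => /(congr1 predn).
have uE : [set u] \subset verts E by rewrite vE subsetUl.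
have HE : H \subset verts E by rewrite vE subsetUr.
have cu := card_thr uE; have cHn := card_thr HE.
rewrite cards1 subn1 in cu; rewrite cH -subn1 subKn // expn1 in cHn.
have eu A : (A \in thr [set u]) = (u \in verts A) by rewrite inE sub1set.
have e1 := cardsID (thr [set u]) (hm_family u B).
have e2 := cardsID (hm_family u B) (thr [set u]).
have e3 := cardsID (thr [set u]) (thr H).
have e4 : hm_family u B :\: thr [set u] = thr H :\: thr [set u].
  by apply/setP => A; rewrite !in_setD eu mem_hm_family mem_thr; case: (u \in _).
have e5 : thr H :&: thr [set u] = [set E].
  apply/setP => A; rewrite in_setI eu mem_thr in_set1 andbC.
  rewrite -sub1set -subUset -vE; apply/idP/eqP => [EA|-> //].
  apply/ffunP => l; have := subsetP EA (l, E l); rewrite !mem_verts /= eqxx.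
  by move/(_ isT)/eqP.
have e6 : thr [set u] :\: hm_family u B = [set A | (u \in verts A) && ~~ meets A B].
  apply/setP => A; rewrite in_setD eu mem_hm_family [RHS]inE andbC.
  by case: (u \in verts A).
move: e1 e2 e3; rewrite e4 e5 e6 cards1 card_thr1_disjoint // setIC cu cHn.
lia.
Qed.

End HiltonMilnerFamily.

(** * Inequalities between powers of n and n - 1 *)

Lemma bernoulli_pred m n : n ^ m.+1 <= n.-1 ^ m.+1 + m.+1 * n ^ m.
Proof.
case: n => [|n]; first by rewrite exp0n.
elim: m => [|m IH]; first by rewrite !expn1 expn0; lia.
rewrite /= in IH *; rewrite [n.+1 ^ m.+2]expnS [n ^ m.+2]expnS.
have le_nm : n ^ m.+1 <= n.+1 ^ m.+1 by rewrite leq_exp2r.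
rewrite [n.+1 ^ m.+1]expnS in IH le_nm *.
move: (n.+1 ^ m) (n ^ m.+1) IH le_nm => a b; nia.
Qed.

(** Second-order Bernoulli bound. For m = r - 3 it shows that a Hilton-Milner family has leading
    term (r-1)n^(r-2), which beats a star with at most r - 2 heavy pairs. *)
Lemma expn_diff_lower m n :
  m.+2 * n ^ m.+1 + n.-1 ^ m.+2 <= n ^ m.+2 + m.+2 ^ 2 * n ^ m.
Proof.
elim: m => [|m IH]; first by rewrite !expn1 expn0 -!mulnn; nia.
have := bernoulli_pred m.+1 n.
rewrite [n ^ m.+3]expnS [n.-1 ^ m.+3]expnS.
rewrite !(expnS n) in IH *.
move: (n ^ m) (n.-1 ^ m.+2) IH => a b; rewrite -!mulnn; nia.
Qed.

(* With equality for m = 0 and m = 1, that is r = 3 and r = 4. *)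
Lemma triangle_le_hilton_milner m n : 0 < n ->
  3 * n ^ m.+1 + n.-1 ^ m.+2 + 1 <= n ^ m.+2 + n + 2 * n ^ m.
Proof.
case: n => // n _ /=; elim: m => [|m IH]; first by rewrite !expn1 expn0 -!mulnn; nia.
have le_n : n ^ 2 <= n ^ m.+2 by case: (posnP n) => [->|n0]; rewrite ?exp0n // leq_pexp2l.
rewrite [n.+1 ^ m.+3]expnS [n ^ m.+3]expnS [n.+1 ^ m.+1]expnS.
rewrite !(expnS n.+1) in IH *.
move: (n.+1 ^ m) (n ^ m.+2) IH le_n => a b; rewrite -mulnn; nia.
Qed.

(** * Intersecting families without a covering vertex *)

Section IntersectingFamilies.

Variables k n : nat.
Variable G : {set edge k.+3 n}.
Hypothesis intG : {in G &, forall A B, meets A B}.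
Hypothesis coverG : forall v, exists2 A, A \in G & v \notin verts A.
Implicit Types (A B E : edge k.+3 n) (F K : {set edge k.+3 n}).
Implicit Types (u v w x : vertex k.+3 n) (S : {set vertex k.+3 n}).

(** Here r = [k.+3], and the threshold r n^(r-3) is the one that makes [heavy_hit] true. *)
Definition heavy u v := (u != v) && (k.+3 * n ^ k < #|G :&: thr [set u; v]|).

Lemma heavyC u v : heavy u v = heavy v u.
Proof. by rewrite /heavy eq_sym setUC. Qed.

Lemma heavy_edge u v : heavy u v ->
  exists A, [/\ A \in G, u \in verts A & v \in verts A].
Proof.
move=> /andP[_ /(leq_ltn_trans (leq0n _))/card_gt0P[A]].
by rewrite in_setI mem_thr subUset !sub1set => /and3P[]; exists A.
Qed.

Lemma heavy_parts u v : heavy u v -> u.1 != v.1.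
Proof.
move=> huv; have [A [_ uA vA]] := heavy_edge huv.
apply/eqP => /(verts_inj_part uA vA) euv.
by move: huv; rewrite /heavy euv eqxx.
Qed.

Lemma card_thr3_le u v w : u != v -> w != u -> w != v ->
  #|[set B in G :&: thr [set u; v] | w \in verts B]| <= n ^ k.
Proof.
move=> uv wu wv; have c3 : #|w |: [set u; v]| = 3.
  by rewrite cardsU1 cards2 !inE negb_or wu wv uv.
have := card_thr_le (w |: [set u; v]); rewrite c3 !subSS subn0; apply: leq_trans.
apply/subset_leq_card/subsetP => B.
by rewrite !inE !subUset !sub1set !inE => /andP[/and3P[_ -> ->] ->].
Qed.

(** If [A] missed both, every edge of [G] through the pair would contain one of the r vertices of
    [A], each of which lies with u and v on at most n^(r-3) edges. *)
Lemma heavy_hit u v A : heavy u v -> A \in G -> (u \in verts A) || (v \in verts A).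
Proof.
move=> /andP[uv]; rewrite ltnNge => /negP h AG; apply: contraT.
rewrite negb_or => /andP[uA vA]; case: h.
rewrite -[X in _ <= X * _](card_verts A); apply: cover_bound => [B|w wA].
  by rewrite in_setI => /andP[BG _]; apply: intG.
by apply: card_thr3_le => //; apply: contraTneq wA => ->.
Qed.

(** Otherwise each edge of [G] through u and v contains a or b by [heavy_hit], so there are at most
    2n^(r-3) of them. *)
Lemma heavy_intersect u v a b :
  heavy u v -> heavy a b -> (a \in [set u; v]) || (b \in [set u; v]).
Proof.
move=> huv hab; apply: contraT; rewrite negb_or !inE !negb_or.
move=> /andP[/andP[au av] /andP[bu bv]].
have /andP[uv] := huv; rewrite ltnNge => /negP[].
apply: leq_trans (_ : 2 * n ^ k <= _); last by rewrite leq_mul2r orbT.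
have <- : #|[set a; b]| = 2 by case/andP: hab; rewrite cards2 => ->.
apply: cover_bound => [B|w].
  rewrite in_setI => /andP[BG _]; apply/meetsP.
  by have /orP[aB|bB] := heavy_hit hab BG; [exists a|exists b]; rewrite // in_set2 eqxx ?orbT.
by move=> /set2P[] ->; apply: card_thr3_le.
Qed.

(** All of [F] meets an edge [C] of [G] that misses v. A vertex w of [C] forming a heavy pair with v
    lies on no edge of [F]; any other lies on at most r n^(r-3). *)
Lemma light_star F v :
    F \subset G -> {in F, forall A, v \in verts A} ->
    (forall w, heavy v w -> {in F, forall A, w \notin verts A}) ->
  #|F| <= k.+3 * (k.+3 * n ^ k).
Proof.
move=> FG vF lightF; have [C CG vC] := coverG v.
rewrite -[X in _ <= X * _](card_verts C); apply: cover_bound => [A AF|w wC].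
  by apply: intG => //; apply: (subsetP FG).
have [hvw|] := boolP (heavy v w).
  rewrite (_ : [set _ in _ | _] = set0) ?cards0 //.
  apply/setP => A; rewrite in_set0 inE; apply/negP => /andP[AF].
  exact/negP/lightF.
rewrite /heavy negb_and -leqNgt negbK => /predU1P[evw|]; first by rewrite evw wC in vC.
apply: leq_trans; apply/subset_leq_card/subsetP => A; rewrite inE => /andP[AF wA].
by rewrite in_setI (subsetP FG) //= mem_thr subUset !sub1set vF.
Qed.

(** All of [G] meets one fixed edge of [G], and the edges through each of its r vertices form a
    light star. *)
Lemma card_no_heavy : (forall u v, ~~ heavy u v) -> #|G| <= k.+3 ^ 3 * n ^ k.
Proof.
move=> noh; have [->|[A AG]] := set_0Vmem G; first by rewrite cards0.
rewrite !expnS expn0 muln1 -!mulnA -[X in _ <= X * _](card_verts A); apply: cover_bound => [B BG|w _].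
  exact: intG.
apply: (@light_star _ w) => [|B|v hwv]; last by rewrite (negbTE (noh _ _)) in hwv.
  by apply/subsetP => B; rewrite inE => /andP[].
by rewrite inE => /andP[].
Qed.

(** Provides a part that changes of coordinates in two given parts leave untouched. *)
Lemma third_part (a b : 'I_k.+3) : exists l, (l != a) && (l != b).
Proof.
have : 0 < #|~: [set a; b]|.
  have := cardsC [set a; b]; rewrite cards2 card_ord; case: (_ != _) => /=; lia.
by case/card_gt0P => l; rewrite !inE negb_or => lab; exists l.
Qed.

(** * The case where u is the only heavy partner of v *)

Section Star.

Variables u v : vertex k.+3 n.
Hypothesis huv : heavy u v.
Hypothesis only_u : forall w, heavy v w -> w = u.

Let H := [set w | heavy u w].

(* Edges missing u, edges through u missing H, and edges through u hitting H. *)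
Lemma card_heavy_star :
  #|G| <= #|H| * n ^ k.+1 + 2 * (k.+3 * (k.+3 * n ^ k)).
Proof.
pose F1 := [set A in G | u \notin verts A].
pose F2 := [set A in G | (u \in verts A) && [disjoint verts A & H]].
pose F3 := [set A in G | (u \in verts A) && ~~ [disjoint verts A & H]].
have sG : G \subset F1 :|: F2 :|: F3.
  apply/subsetP => A AG; rewrite !in_setU ![A \in [set _ in _ | _]]inE AG /=.
  by case: (u \in verts A); case: [disjoint _ & _].
(* Edges missing u pass through v, whose only heavy partner is u: a light star at v. *)
have c1 : #|F1| <= k.+3 * (k.+3 * n ^ k).
  apply: (@light_star _ v) => [|A|w /only_u -> A].
  - by apply/subsetP => A; rewrite inE => /andP[].
  - by rewrite inE => /andP[AG uA]; have := heavy_hit huv AG; rewrite (negbTE uA).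
  - by rewrite inE => /andP[].
have c2 : #|F2| <= k.+3 * (k.+3 * n ^ k).
  apply: (@light_star _ u) => [|A|w huw A].
  - by apply/subsetP => A; rewrite inE => /andP[].
  - by rewrite inE => /and3P[].
  - rewrite inE => /and3P[_ _ dAH]; apply/negP => wA.
    by have := disjointFr dAH wA; rewrite inE huw.
have c3 : #|F3| <= #|H| * n ^ k.+1.
  apply: cover_bound => [A|w]; first by rewrite inE => /and3P[].
  rewrite inE => /andP[uw _].
  have := card_thr_le [set u; w]; rewrite cards2 uw !subSS subn0; apply: leq_trans.
  apply/subset_leq_card/subsetP => A; rewrite [A \in [set _ in _ | _]]inE [A \in F3]inE.
  by rewrite mem_thr subUset !sub1set => /andP[/and3P[_ -> _] ->].
have := subset_leq_card sG.
have := (leq_card_setU (F1 :|: F2) F3).1; have := (leq_card_setU F1 F2).1; lia.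
Qed.

(** An edge that misses u contains every heavy partner of u by [heavy_hit], and no such partner lies
    in the part of u. *)
Lemma heavy_star_sub B : B \in G -> u \notin verts B ->
  H \subset verts B :\ (u.1, B u.1).
Proof.
move=> BG uB; apply/subsetP => w; rewrite inE => huw.
rewrite in_setD1; have := heavy_hit huw BG; rewrite (negbTE uB) /= => ->.
by rewrite andbT; apply: contra_neqN (heavy_parts huw) => /eqP ->.
Qed.

Lemma card_star_le S :
    k.+3 ^ 3 <= n -> #|S| < n -> {in G, forall A, A \notin hitting S} ->
  #|G| + #|S| + n.-1 ^ k.+2 + 1 <= n ^ k.+2 + n.
Proof.
move=> n_large S_small GS; have [B BG uB] := coverG u.
(* With at most r - 2 heavy partners, one spare n^(r-2) must absorb 2r^2 + (r-1)^2 copies of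
   n^(r-3); n >= r^3 suffices as r >= 3. *)
have [H_small|H_large] := leqP #|H| k.+1.
  have := card_heavy_star; have := expn_diff_lower k n.
  have : #|H| * n ^ k.+1 <= k.+1 * n ^ k.+1 by rewrite leq_mul2r H_small orbT.
  have : k.+3 ^ 3 * n ^ k <= n ^ k.+1 by rewrite (expnS n k) leq_mul2r n_large orbT.
  move: S_small; rewrite !(expnS _ k); move: (n ^ k) #|H| #|G| #|S| => a h g t.
  clear; rewrite !expnS expn0; nia.
(* With r - 1 heavy partners, all edges of [G] missing u coincide with [H], hence with [B], outside
   the part of u. *)
have eH A : A \in G -> u \notin verts A -> H = verts A :\ (u.1, A u.1).
  move=> AG uA; apply/eqP; rewrite eqEcard heavy_star_sub //=.
  have := cardsD1 (u.1, A u.1) (verts A).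
  by rewrite card_verts mem_verts /= eqxx add1n => -[<-].
have GK : G \subset hm_family u B.
  apply/subsetP => A AG; rewrite mem_hm_family; case: ifPn => uA; first exact: intG.
  by rewrite -(eH B) // (eH A) // subsetDl.
have uS : u \notin S.
  have [A [AG uA _]] := heavy_edge huv; have := GS A AG.
  by rewrite inE negbK => dAS; rewrite (disjointFr dAS uA).
have BS : [disjoint verts B & S] by have := GS B BG; rewrite inE negbK.
have ES : upd B u \notin hitting S.
  rewrite inE negbK verts_upd_D1; apply/pred0P => w /=; apply/negP => /andP[].
  rewrite !in_setU1 in_setD1 => /predU1P[->|/andP[_ wB]]; first by rewrite (negbTE uS).
  by rewrite (disjointFr BS wB).
(* A change in the part of u yields an edge off u that agrees with [B] elsewhere; a change in
   another part keeps u and leaves a third part in which to meet [B]. *)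
have xK x : x \in S -> upd (upd B u) x \in hm_family u B.
  move=> xS; rewrite mem_hm_family !verts_upd.
  have [exu|nxu] := eqVneq x.1 u.1.
    case: eqP => [eux|_]; first by rewrite eux xS in uS.
    apply/subsetP => w; rewrite in_setD1 => /andP[wBu wB].
    have wu : w.1 != u.1.
      apply: contraNneq wBu => ewu; apply/eqP/(verts_inj_part wB) => //.
      by rewrite mem_verts.
    by rewrite !verts_upd exu (negbTE wu).
  rewrite !eqxx.
  have [l /andP[lu lx]] := third_part u.1 x.1; apply/meetsP; exists (l, B l).
    by rewrite !verts_upd /= (negbTE lu) (negbTE lx) mem_verts /=.
  by rewrite mem_verts.
have := card_avoiding_le GK GS ES xK; have := card_hm_family uB => /=; lia.
Qed.

End Star.

(** By [heavy_hit] every edge of [G] contains two of u, v, w, and inclusion-exclusion counts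
    3n^(r-2) - 2n^(r-3) such edges. An edge [E] through all three keeps two of them after any single
    change, which supplies the edges through [S]. *)
Lemma card_triangle_le u v w S :
    heavy u v -> heavy v w -> heavy u w ->
    0 < n -> {in G, forall A, A \notin hitting S} ->
  #|G| + #|S| + n.-1 ^ k.+2 + 1 <= n ^ k.+2 + n.
Proof.
move=> huv hvw huw n_gt0 GS.
have notS x y : heavy x y -> y \notin S.
  move=> hxy; have [A [AG _ yA]] := heavy_edge hxy; have := GS A AG.
  by rewrite inE negbK => dAS; rewrite (disjointFr dAS yA).
have [pu pv pw] := And3 (heavy_parts huv) (heavy_parts hvw) (heavy_parts huw).
have [E [uE vE wE ES]] : exists E,
    [/\ u \in verts E, v \in verts E, w \in verts E & E \notin hitting S].
  have [A [AG uA vA]] := heavy_edge huv; exists (upd A w).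
  have AS : [disjoint verts A & S] by have := GS A AG; rewrite inE negbK.
  split; rewrite ?verts_upd ?(negbTE pw) ?(negbTE pv) ?eqxx //.
  rewrite inE negbK; apply/pred0P => x /=; apply/negP => /andP[].
  rewrite verts_upd; case: ifP => [_ /eqP ->|_ xA]; first by rewrite (negbTE (notS _ _ hvw)).
  by rewrite (disjointFr AS xA).
have sub2 x y : (x \in verts E) -> (y \in verts E) -> [set x; y] \subset verts E.
  by move=> xE yE; rewrite subUset !sub1set xE.
have nuv := andP huv; have nvw := andP hvw; have nuw := andP huw.
pose X := thr [set u; v]; pose Y := thr [set v; w]; pose Z := thr [set u; w].
pose T := thr (w |: [set u; v]).
have cX : #|X| = n ^ k.+1 by rewrite (card_thr (sub2 _ _ uE vE)) cards2 nuv.1 !subSS subn0.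
have cY : #|Y| = n ^ k.+1 by rewrite (card_thr (sub2 _ _ vE wE)) cards2 nvw.1 !subSS subn0.
have cZ : #|Z| = n ^ k.+1 by rewrite (card_thr (sub2 _ _ uE wE)) cards2 nuw.1 !subSS subn0.
have cT : #|T| = n ^ k.
  rewrite (@card_thr _ _ _ E); last by rewrite subUset sub1set wE sub2.
  by rewrite cardsU1 cards2 nuv.1 !inE negb_or eq_sym nuw.1 eq_sym nvw.1 !subSS subn0.
have eXY : X :&: Y = T.
  apply/setP => B; rewrite in_setI !mem_thr !subUset !sub1set.
  by case: (u \in _); case: (v \in _); case: (w \in _).
have eXYZ : (X :|: Y) :&: Z = T.
  apply/setP => B; rewrite in_setI in_setU !mem_thr !subUset !sub1set.
  by case: (u \in _); case: (v \in _); case: (w \in _).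
have GK : G \subset X :|: Y :|: Z.
  apply/subsetP => B BG; rewrite !in_setU !mem_thr !subUset !sub1set.
  move: (heavy_hit huv BG) (heavy_hit hvw BG) (heavy_hit huw BG).
  by case: (u \in _); case: (v \in _); case: (w \in _).
have xK x : x \in S -> upd E x \in X :|: Y :|: Z.
  move=> xS; rewrite !in_setU !mem_thr !subUset !sub1set !(verts_upd E x) uE vE wE.
  have [e|] := eqVneq u.1 x.1.
    by rewrite -e (eq_sym v.1) (eq_sym w.1) (negbTE pu) (negbTE pw) !orbT.
  have [e|] := eqVneq v.1 x.1; last by [].
  by rewrite -e (eq_sym w.1) (negbTE pv) !orbT.
have := card_avoiding_le GK GS ES xK; have := triangle_le_hilton_milner k n_gt0.
have := cardsUI (X :|: Y) Z; have := cardsUI X Y; rewrite eXY eXYZ cX cY cZ cT.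
move: #|X :|: Y| #|X :|: Y :|: Z| #|G| #|S| (n.-1 ^ _) (n ^ _) (n ^ _) (n ^ _).
by clear; lia.
Qed.

(** Take a heavy pair u, v. If one end has no other heavy partner, the star case applies at the
    opposite end. Otherwise v has a partner w and u a partner x, and [heavy_intersect] forces x = w:
    a triangle. *)
Lemma card_intersecting_le S :
    k.+3 ^ 3 <= n -> #|S| < n -> {in G, forall A, A \notin hitting S} ->
  #|G| + #|S| + n.-1 ^ k.+2 + 1 <= n ^ k.+2 + n.
Proof.
move=> n_large S_small GS.
have n_gt0 : 0 < n by apply: leq_trans n_large; rewrite expn_gt0.
have [/existsP[[u v] /= huv]|/existsPn noh] := boolP [exists p, heavy p.1 p.2]; last first.
  have /card_no_heavy : forall u v, ~~ heavy u v by move=> u v; exact: (noh (u, v)).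
  have : k.+3 ^ 3 * n ^ k <= n ^ k.+1 by rewrite (expnS n k) leq_mul2r n_large orbT.
  have : n.-1 ^ k.+2 + n ^ k.+1 <= n ^ k.+2.
    have : n.-1 ^ k.+1 <= n ^ k.+1 by rewrite leq_exp2r ?leq_pred.
    rewrite !(expnS _ k.+1); move: n_gt0; move: (n.-1 ^ k.+1) (n ^ k.+1); clear; nia.
  by move: S_small; clear; lia.
have [/existsP[w /andP[wu hvw]]|/existsPn nw] := boolP [exists w, (w != u) && heavy v w]; last first.
  apply: (@card_star_le u v) => // w hvw; apply/eqP.
  by have := nw w; rewrite hvw andbT negbK.
have [/existsP[x /andP[xv hux]]|/existsPn nx] := boolP [exists x, (x != v) && heavy u x]; last first.
  apply: (@card_star_le v u) => //; first by rewrite heavyC.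
  by move=> x hux; apply/eqP; have := nx x; rewrite hux andbT negbK.
have exw : x = w.
  have := heavy_intersect hvw hux; rewrite !inE (negbTE xv) /=.
  have /andP[/negbTE nuv _] := huv.
  by rewrite nuv eq_sym (negbTE wu) /= => /eqP.
by apply: (card_triangle_le huv hvw) => //; rewrite -exw.
Qed.


End IntersectingFamilies.

(** * The upper bound *)

Lemma exists_subset_card (T : finType) (A : {set T}) m : m <= #|A| ->
  exists2 B : {set T}, B \subset A & #|B| = m.
Proof.
move=> mA; have : 0 < #|[set B : {set T} | B \subset A & #|B| == m]|.
  by rewrite cards_draws bin_gt0.
by case/card_gt0P => B; rewrite inE => /andP[BA /eqP]; exists B.
Qed.

Lemma card_upper_bound k n s (F : {set edge k.+3 n}) :
    k.+3 ^ 3 + s * k.+3 * (k.+3 * s.+1) < n -> nu F <= s < tau F ->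
  #|F| + n.-1 ^ k.+2 + s <= s * n ^ k.+2 + n.
Proof.
move=> n_large /andP[nuF tauF].
pose deg v := #|[set A in F | v \in verts A]|.
pose big := [set v | k.+3 * s.+1 * n ^ k.+1 < deg v].
have greedy (S : {set vertex k.+3 n}) M : S \subset big -> is_matching F M ->
    {in M, forall A, A \notin hitting S} -> #|M| + #|S| <= s.+1 -> #|M| + #|S| <= s.
  move=> Sbig; apply: greedy_matching => // v /(subsetP Sbig).
  by rewrite inE.
(* Since [tau F] exceeds s, some edge avoids s given big vertices; with it, [greedy] would yield 1 +
   s <= s. *)
have big_lt : #|big| < s.
  rewrite ltnNge; apply/negP => /exists_subset_card[S Sbig cS].
  have [|A AF AS] := @avoiding_edge _ _ F S; first by rewrite cS.
  have := greedy S [set A] Sbig (matching_set1 AF).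
  rewrite cards1 cS add1n ltnn => h; suff : false by []; apply: h => // B.
  by rewrite inE => /eqP ->.
pose F' := [set A in F | A \notin hitting big].
have F'big A : A \in F' -> A \notin hitting big by rewrite inE => /andP[].
have F'F : F' \subset F by apply/subsetP => A; rewrite inE => /andP[].
have cF : #|F| <= #|big| * n ^ k.+2 + #|F'|.
  have sF : F \subset hitting big :|: F'.
    by apply/subsetP => A AF; rewrite in_setU [A \in F']inE AF /=; case: (A \in _).
  have := subset_leq_card sF; have := (leq_card_setU (hitting big) F').1.
  have := card_hitting_le big => /=; move: (n ^ _) => a; lia.
have s_lt_n : s < n by move: n_large; clear; nia.
have [big_eq|big_neq] := eqVneq #|big|.+1 s.
  have := @card_intersecting_le k n F' _ _ big.
  (* Two disjoint edges avoiding the s - 1 big vertices would contradict [greedy], as 2 + (s - 1) >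
     s. *)
  have intF' : {in F' &, forall A B, meets A B}.
    move=> A B AF' BF'; apply: contraT => nAB.
    have AB : A \notin [set B].
      by rewrite inE; apply: contra nAB => /eqP ->; apply: meetsxx.
    have mAB : is_matching F (A |: [set B]).
      apply: matching_setU1; [apply: matching_set1|..]; rewrite ?(subsetP F'F) //.
      by move=> C; rewrite inE => /eqP ->.
    have := greedy big (A |: [set B]) (subxx _) mAB.
    rewrite cardsU1 AB cards1 -big_eq => h.
    suff : false by []; move: h; rewrite !addSn add0n ltnn; apply=> //.
    by move=> C; rewrite !inE => /orP[] /eqP ->; move: (F'big _ AF') (F'big _ BF'); rewrite !inE.
  (* Adding v to [big] gives at most s vertices, hence no transversal. *)
  have coverF' v : exists2 A, A \in F' & v \notin verts A.
    have [|A AF AT] := @avoiding_edge _ _ F (v |: big).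
      by apply: leq_trans tauF; rewrite ltnS cardsU1 -big_eq; case: (_ \notin _).
    move: AT; rewrite inE negbK => dA; exists A.
      by rewrite inE AF inE negbK; apply: disjointWr dA; apply: subsetUr.
    by apply/negP => vA; have := disjointFr dA vA; rewrite setU11.
  move=> /(_ intF' coverF') h.
  have {}h : #|F'| + #|big| + n.-1 ^ k.+2 + 1 <= n ^ k.+2 + n.
    by apply: h => //; move: n_large s_lt_n big_eq; clear; lia.
  move: cF h big_eq; rewrite -/(deg _); clear.
  move: #|F| #|F'| #|big| (n ^ _) (n.-1 ^ _) => f f' b a c; nia.
(* By maximality the vertices of [M] cover [F'], and none of them is big. *)
have [M matM maxM] : exists2 M, is_matching F' M &
    forall M', is_matching F' M' -> #|M'| <= #|M|.
  have m0 : is_matching F' set0.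
    by apply/is_matchingP; split=> [|B C]; rewrite ?sub0set ?inE.
  by case: (arg_maxnP (fun M : {set edge k.+3 n} => #|M|) m0) => M; exists M.
have /is_matchingP[MF' dM] := matM.
have cM : #|M| <= s.
  apply: leq_trans nuF; apply/card_matching_nu/is_matchingP; split=> //.
  exact: subset_trans F'F.
have cF' : #|F'| <= s * k.+3 * (k.+3 * s.+1 * n ^ k.+1).
  apply: leq_trans (_ : #|\bigcup_(A in M) verts A| * (k.+3 * s.+1 * n ^ k.+1) <= _); last first.
    rewrite leq_mul2r; apply/orP; right; apply: leq_trans (card_bigcup_verts M) _.
    by rewrite leq_mul2r cM orbT.
  apply: cover_bound => [A AF'|w /bigcupP[B BM wB]].
    apply: contraT; rewrite negbK => dAM.
    have dA B : B \in M -> ~~ meets A B.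
      by move=> BM; rewrite negbK; apply: disjointWr dAM; apply: bigcup_sup.
    have := maxM _ (matching_setU1 matM AF' dA); rewrite cardsU1.
    have -> : A \notin M by apply/negP => /dA; rewrite meetsxx.
    by rewrite add1n ltnn.
  have wbig : w \notin big.
    apply/negP => wb; have := F'big _ (subsetP MF' _ BM); rewrite inE negbK => dB.
    by have := disjointFr dB wB; rewrite wb.
  rewrite inE -leqNgt in wbig; apply: leq_trans wbig.
  apply/subset_leq_card/subsetP => A; rewrite ![A \in [set _ in _ | _]]inE.
  by move=> /andP[/andP[-> _] ->].
have big2 : #|big|.+2 <= s by rewrite ltn_neqAle big_neq.
have : n.-1 ^ k.+2 <= n ^ k.+2 by rewrite leq_exp2r ?leq_pred.
have : s * k.+3 * (k.+3 * s.+1) * n ^ k.+1 <= n ^ k.+2.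
  rewrite (expnS n k.+1) leq_mul2r; apply/orP; right.
  by move: n_large; clear; lia.
(* Two spare copies of n^(r-1) remain: one absorbs [F'], the other (n-1)^(r-1). *)
have : #|big|.+2 * n ^ k.+2 <= s * n ^ k.+2 by rewrite leq_mul2r big2 orbT.
move: cF cF' s_lt_n; clear; rewrite -!mulnA.
move: #|F| #|F'| #|big| (n ^ k.+2) (n.-1 ^ _) => f f' b a c; nia.
Qed.

(** An edge through u meets [B] outside the part of u, where edges off u contain [B]. Two edges off
    u share a vertex of [B] in any other part. *)
Lemma hm_family_intersecting k n (u : vertex k.+3 n) (B : edge k.+3 n) :
  u \notin verts B -> {in hm_family u B &, forall A C, meets A C}.
Proof.
move=> uB.
have mix A C : u \in verts A -> u \notin verts C ->
    A \in hm_family u B -> C \in hm_family u B -> meets A C.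
  move=> uA uC; rewrite !mem_hm_family uA (negbTE uC) => /meetsP[x xA xB] BC.
  apply/meetsP; exists x => //; apply: (subsetP BC); rewrite in_setD1 xB andbT.
  apply: contraNneq uB => ex; suff -> : u = x by [].
  by apply: (verts_inj_part uA xA); rewrite ex.
move=> A C AK CK; have [uA|uA] := boolP (u \in verts A); have [uC|uC] := boolP (u \in verts C).
- by apply/meetsP; exists u.
- exact: mix.
- by rewrite /meets disjoint_sym; apply: mix.
- move: AK CK; rewrite !mem_hm_family (negbTE uA) (negbTE uC) => BA BC.
  have [l /andP[lu _]] := third_part u.1 u.1.
  have lB : (l, B l) \in verts B :\ (u.1, B u.1).
    by rewrite in_setD1 xpair_eqE (negbTE lu) mem_verts /=.
  by apply/meetsP; exists (l, B l); [apply: (subsetP BA)|apply: (subsetP BC)].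
Qed.

(** * The extremal example *)

Section Construction.

Variables k m t : nat.
Hypothesis t_lt_m : t < m.

Let n := m.+1.
(** Here s = [t.+1]. In part 0 the values below t form [S0], t is the centre [u], and [t.+1] lies on
    [B0]; [t < m] keeps all of them in range. *)
Let S0 : {set vertex k.+3 n} := setX [set ord0] [set j : 'I_n | j < t].
Let u : vertex k.+3 n := (ord0, inord t).
Let B0 : edge k.+3 n := [ffun l => if l == ord0 then inord t.+1 else ord0].
Let E0 : edge k.+3 n := upd B0 u.
Let F0 := hitting S0 :|: hm_family u B0.

Lemma card_lt_ord : #|[set j : 'I_n | j < t]| = t.
Proof.
have le_tn : t <= n by rewrite /n; lia.
have -> : [set j : 'I_n | j < t] = widen_ord le_tn @: [set: 'I_t].
  apply/setP => j; rewrite inE; apply/idP/imsetP => [jt|[i _ ->] /=].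
    by exists (Ordinal jt) => //; apply: val_inj.
  exact: ltn_ord.
by rewrite card_imset ?cardsT ?card_ord // => i j [] /val_inj.
Qed.

Lemma card_S0 : #|S0| = t.
Proof. by rewrite cardsX cards1 mul1n card_lt_ord. Qed.

Lemma mem_hitting_S0 A : (A \in hitting S0) = (A ord0 < t).
Proof.
rewrite inE; apply/meetsP/idP => [[[l j]]|At].
  by rewrite mem_verts in_setX !inE /= => /eqP <- /andP[/eqP ->].
by exists (ord0, A ord0); rewrite ?mem_verts // in_setX !inE eqxx.
Qed.

Lemma card_hitting_S0 : #|hitting S0| = t * n ^ k.+2.
Proof.
have -> : hitting S0 = [set A : edge k.+3 n | [forall l, A l \in
    if l == ord0 then [set j : 'I_n | j < t] else setT]].
  apply/setP => A; rewrite mem_hitting_S0 inE; apply/idP/forallP => [At l|/(_ ord0)].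
    by case: ifP => [/eqP ->|]; rewrite inE.
  by rewrite eqxx inE.
rewrite card_edge_prod big_ord_recl eqxx card_lt_ord; congr (_ * _).
rewrite (eq_bigr (fun=> n)); last by move=> l _; rewrite /= cardsT card_ord.
by rewrite prod_nat_const card_ord.
Qed.

Lemma u_notin_B0 : u \notin verts B0.
Proof.
rewrite mem_verts ffunE eqxx; apply/eqP => /(congr1 val) /=.
by rewrite !inordK ?ltnS //; lia.
Qed.

(** The two families share at most t edges: an edge hitting [S0] misses [u], so in the Hilton-Milner
    family it is [B0] with its part-0 vertex replaced by one of [S0]. *)
Lemma card_F0 : t * n ^ k.+2 + n ^ k.+2 + n <= #|F0| + n.-1 ^ k.+2 + t.+1.
Proof.
have := cardsUI (hitting S0) (hm_family u B0); have := card_hm_family u_notin_B0.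
rewrite -/F0 card_hitting_S0 /=.
have : #|hitting S0 :&: hm_family u B0| <= t.
  rewrite -[X in _ <= X]card_S0; apply: leq_trans (leq_imset_card (upd B0) _).
  apply/subset_leq_card/subsetP => A; rewrite in_setI mem_hitting_S0 => /andP[At].
  have uA : u \notin verts A.
    rewrite mem_verts; apply: contraTneq At => ->.
    by rewrite inordK -?leqNgt // ltnS ltnW.
  rewrite mem_hm_family (negbTE uA) => BA; apply/imsetP; exists (ord0, A ord0).
    by rewrite in_setX !inE eqxx.
  apply/ffunP => l; rewrite ffunE /=; case: eqVneq => [-> //|l0].
  have := subsetP BA (l, B0 l); rewrite in_setD1 xpair_eqE (negbTE l0) !mem_verts /= eqxx.
  by move=> /(_ isT)/eqP.
clear; move: #|_ :&: _| #|F0| #|hm_family _ _| (n ^ _) (m ^ _) => a b c d e; lia.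
Qed.

(** A matching has at most one edge per vertex of [S0], plus one from the intersecting Hilton-Milner
    family. *)
Lemma nu_F0 : nu F0 <= t.+1.
Proof.
apply/bigmax_leqP => M /is_matchingP[MF dM].
have := cardsID (hitting S0) M; have : #|M :&: hitting S0| <= #|S0| * 1.
  apply: cover_bound => [A|w _]; first by rewrite in_setI => /andP[_]; rewrite inE.
  apply/card_le1_eqP => A B; rewrite !inE.
  move=> /andP[/andP[AM _] wA] /andP[/andP[BM _] wB].
  apply/eqP; apply: contraT => nAB; have /negP[] := dM B A BM AM nAB; by apply/meetsP; exists w; rewrite inE.
have : #|M :\: hitting S0| <= 1.
  apply/card_le1_eqP => A B; rewrite !in_setD => /andP[AS AM] /andP[BS BM].
  have K C : C \in M -> C \notin hitting S0 -> C \in hm_family u B0.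
    by move=> /(subsetP MF); rewrite in_setU => /orP[->|].
  apply/eqP; apply: contraT => nAB; have /negP[] := dM B A BM AM nAB.
  by apply: (hm_family_intersecting u_notin_B0); apply: K.
rewrite card_S0; clear; lia.
Qed.

(** [E0] works unless it contains v. For v = [u] take [B0]; otherwise v has value 0 in another part,
    and changing it to 1 keeps [u] and a common vertex with [B0] in a third part. *)
Lemma hm_avoiding v : exists A,
  [/\ A \in hm_family u B0, v \notin verts A & A \notin hitting S0].
Proof.
have tn : t < m.+1 by lia.
have E00 : E0 ord0 = inord t by rewrite ffunE eqxx.
have uE : u \in verts E0 by rewrite mem_upd.
have E0l l : l != ord0 -> E0 l = ord0 by move=> l0; rewrite !ffunE /= (negbTE l0).
have B0l l : l != ord0 -> B0 l = ord0 by move=> l0; rewrite !ffunE /= (negbTE l0).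
have [vE|vE] := boolP (v \in verts E0); last first.
  exists E0; split=> //; last by rewrite mem_hitting_S0 E00 inordK // ltnn.
  rewrite mem_hm_family uE; have [l /andP[l0 _]] := third_part (ord0 : 'I_k.+3) ord0.
  by apply/meetsP; exists (l, ord0); rewrite mem_verts /= ?E0l ?B0l.
have [->|nvu] := eqVneq v u.
  exists B0; split; rewrite ?u_notin_B0 //.
    by rewrite mem_hm_family (negbTE u_notin_B0) subsetDl.
  by rewrite mem_hitting_S0 ffunE eqxx inordK ?ltnS // -leqNgt; lia.
have v0 : v.1 != ord0.
  by apply: contra_neq nvu => v0; apply: (verts_inj_part vE uE).
have ev : v.2 = ord0 by move: vE; rewrite mem_verts E0l // => /eqP.
pose x : vertex k.+3 n := (v.1, inord 1).
have [l /andP[l0 lv]] := third_part ord0 v.1.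
exists (upd E0 x); split.
- rewrite mem_hm_family verts_upd /= eq_sym (negbTE v0) uE.
  apply/meetsP; exists (l, ord0); last by rewrite mem_verts /= B0l.
  by rewrite verts_upd /= (negbTE lv) mem_verts /= E0l.
- rewrite verts_upd eqxx; apply/eqP => /(congr1 (fun y => val y.2)) /=.
  by rewrite ev inordK //= ltnS; lia.
- by rewrite mem_hitting_S0 ffunE eq_sym (negbTE v0) E00 inordK // ltnn.
Qed.

(** A transversal [T] of size at most t + 1 < n leaves a free vertex in each part. If it omitted x
    in [S0], an edge through x and otherwise free vertices would avoid it. So [T] is [S0] with at
    most one extra vertex, against [hm_avoiding]. *)
Lemma tau_F0 : t.+1 < tau F0.
Proof.
apply: tau_gt => [|T /is_transversalP tT]; first by rewrite /n; nia.
rewrite ltnNge; apply/negP => cT.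
have S0T : S0 \subset T.
  apply/subsetP => x xS0; apply: contraT => xT.
  have free l : exists y, (l, y) \notin T.
    apply/existsP; apply: contraT; rewrite negb_exists => /forallP allT.
    have : #|[set (l, y) | y : 'I_n]| <= #|T|.
      apply/subset_leq_card/subsetP => _ /imsetP[y _ ->].
      by have := allT y; rewrite negbK.
    by rewrite card_imset ?card_ord => [|y z []//]; move: cT t_lt_m; rewrite /n; lia.
  have [f fT] := fin_all_exists free.
  pose A : edge k.+3 n := [ffun l => f l].
  have : upd A x \in hitting T.
    apply: tT; rewrite in_setU; apply/orP; left; rewrite inE; apply/meetsP.
    by exists x; rewrite ?mem_upd.
  rewrite inE => /meetsP[v]; rewrite verts_upd; case: ifP => _.
    by move=> /eqP ->; rewrite (negbTE xT).
  by rewrite mem_verts ffunE; case: v => l y /= /eqP <-; rewrite (negbTE (fT l)).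
have cTS : #|T :\: S0| <= 1.
  by have := cardsID S0 T; rewrite (setIidPr S0T) card_S0; move: cT; lia.
have [v vT] : exists v, T \subset v |: S0.
  have [e|[v vTS]] := set_0Vmem (T :\: S0).
    by exists u; apply: subset_trans (subsetUr _ _); rewrite -setD_eq0 e.
  exists v; apply/subsetP => w wT; rewrite in_setU1.
  have [wS|wS] := boolP (w \in S0); rewrite ?orbT // orbF.
  by apply/eqP/(card_le1_eqP cTS) => //; rewrite in_setD wS.
have [A [AK vA AS]] := hm_avoiding v.
have : A \in hitting T by apply: tT; rewrite in_setU AK orbT.
rewrite inE => /meetsP[w wA /(subsetP vT)/setU1P[ewv|wS]].
  by rewrite -ewv wA in vA.
by move: AS; rewrite inE => /negP[]; apply/meetsP; exists w.
Qed.

Lemma m0_lower_bound :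
  t * n ^ k.+2 + n ^ k.+2 + n <= m0 k.+3 n t.+1 + n.-1 ^ k.+2 + t.+1.
Proof.
apply: leq_trans card_F0 _; rewrite !leq_add2r.
by apply: leq_bigmax_cond; rewrite nu_F0 tau_F0.
Qed.

End Construction.

(** * From the two bounds to the integer formula *)

Import GRing.Theory Num.Theory.
Local Open Scope ring_scope.

Theorem theorem1p2 (r s : nat) :
  (3 <= r)%N -> (2 <= s)%N ->
  exists N : nat, forall n : nat, (N < n)%N ->
    (m0 r n s)%:Z =
      (s%:Z * (n%:Z) ^+ (r.-1) - (n%:Z - 1) ^+ (r.-1) + n%:Z - s%:Z).
Proof.
case: r => [|[|[|k]]] // _; case: s => // t t_ge1.
(* The first summand serves the intersecting families, the second the case of at most s - 2 big
   vertices. *)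
exists (k.+3 ^ 3 + t.+1 * k.+3 * (k.+3 * t.+2))%N => n n_large.
have lo : (t * n ^ k.+2 + n ^ k.+2 + n <= m0 k.+3 n t.+1 + n.-1 ^ k.+2 + t.+1)%N.
  by case: n n_large => // m m_large; apply: m0_lower_bound; move: m_large; clear; nia.
have up : (m0 k.+3 n t.+1 + n.-1 ^ k.+2 + t.+1 <= t.+1 * n ^ k.+2 + n)%N.
  (* Isolates [m0] so that the maximum is bounded family by family; the side goal makes the
     truncated subtraction exact. *)
  rewrite -addnA addnC -leq_subRL; last first.
    have : (n.-1 ^ k.+2 <= n ^ k.+2)%N by rewrite leq_exp2r ?leq_pred.
    have : (t.+1 < n)%N by move: n_large; clear; nia.
    by rewrite mulSn; move: (n ^ _)%N (n.-1 ^ _)%N; clear; lia.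
  apply/bigmax_leqP => F hF; have := card_upper_bound n_large hF.
  by clear; lia.
have -> : n%:Z - 1 = n.-1%:Z by move: n_large; clear; lia.
have PoszX x j : x%:Z ^+ j = (x ^ j)%N%:Z.
  by elim: j => // j IH; rewrite exprS IH expnS PoszM.
rewrite !PoszX; move: lo up; rewrite mulSn; clear.
move: (m0 _ _ _) (n ^ _)%N (n.-1 ^ _)%N => a b c; nia.
Qed.
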